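(* Suppose that for some integer $m\ge 0$ the sequence $\left(\{d_{2^p}(-1)^m L_{2^p,m}\}\right)_{p}$ is asymptotically non-decreasing, i.e. there is $p_0$ with $2^{p_0}\ge m$ such that $\{d_{2^{p+1}}(-1)^m L_{2^{p+1},m}\}\ge \{d_{2^p}(-1)^m L_{2^p,m}\}$ for all integers $p\ge p_0$. Then Euler's constant $\gamma$ is irrational.
   Context: $\gamma=\lim_{n\to\infty}\left(\sum_{k=1}^n \frac1k-\ln n\right)$ is Euler's constant. $d_n:=\mathrm{LCM}(1,\ldots,n)$ is the least common multiple of the first $n$ positive integers. $\{x\}=x-\lfloor x\rfloor$ is the fractional part of the real number $x$. For integers $0\le m\le n$, $$L_{n,m}:=\sum_{k=0}^n\binom{n}{k}\binom{n+k}{k}(-1)^{n+k}\ln(n-m+k+1).$$ *)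

(* Defs.v *)
From HB Require Import structures.
From mathcomp Require Import all_boot all_order all_algebra.
From mathcomp Require Import all_classical all_reals all_analysis.
Set Implicit Arguments.
Unset Strict Implicit.
Unset Printing Implicit Defensive.
Import Order.TTheory GRing.Theory Num.Theory.
Import numFieldNormedType.Exports.
Local Open Scope classical_set_scope.
Local Open Scope ring_scope.

(* The term at n = 0 uses the convention ln 0 = 0; it does not affect the
   limit. *)
Definition euler_gamma (R : realType) : R :=
  limn (fun n : nat => \sum_(1 <= k < n.+1) (k%:R : R)^-1 - ln (n%:R : R)).

Definition lcm_upto (n : nat) : nat := \big[lcmn/1%N]_(1 <= k < n.+1) k.

Definition frac_part (R : realType) (x : R) : R := x - (Num.floor x)%:~R.

(* Meaningful only for m <= n: the subtraction n - m is the truncated one on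
   nat. *)
Definition Lnm (R : realType) (n m : nat) : R :=
  \sum_(0 <= k < n.+1)
    ('C(n, k))%:R * ('C(n + k, k))%:R * (-1) ^+ (n + k)
      * ln (((n - m + k + 1)%N)%:R : R).

Definition frac_seq (R : realType) (m p : nat) : R :=
  frac_part ((lcm_upto (2 ^ p))%:R * (-1) ^+ m * Lnm R (2 ^ p) m).

(* Main.v *)
Require Import Defs.
From mathcomp Require Import all_boot all_order all_algebra.
From mathcomp Require Import ring lra zify.
From mathcomp Require Import all_classical all_reals all_analysis.
Set Implicit Arguments.
Unset Strict Implicit.
Import Order.TTheory GRing.Theory Num.Theory.
Import numFieldNormedType.Exports.
Local Open Scope classical_set_scope.
Local Open Scope ring_scope.

(* Let c_k be the coefficients of the shifted Legendre polynomial of degree n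
   and H_k the harmonic numbers.  Everything rests on
     gamma + L_(n,m) - \sum_k c_k H_k = \int_(n-m)^(n-m+1) psi_n(z) dz,
   where, with (x)_n the rising factorial,
     psi_n(z) = \sum_(k > n) (z - n)_(n+1) / (k (k + z - n)_(n+1)).
   The series psi_n telescopes under z -> z + 1, its increment being
   \sum_k c_k / (z + k + 1), and this determines it.  On (n - m, n - m + 1) every
   term of the series has sign (-1)^m and, m being fixed, is divided by at least
   4 when n is replaced by n + 1.  Hence (-1)^m times the left-hand side, I_n, is
   positive and I_(2n) <= 4^(-n) I_n.  Since d_(2n) divides d_n C(2n, n) and
   2 C(2n, n) <= 4^n, d_(2^p) I_(2^p) is at least halved at each step.  If gamma
   is rational this number eventually is the fractional part of
   d_(2^p) (-1)^m L_(2^p, m), which therefore strictly decreases.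
   The integral is handled as a limit of Riemann sums over the grid i/N: these
   have a closed form in harmonic numbers (psi_average). *)

(** * Rising factorials *)

Definition rising {F : pzSemiRingType} (x : F) (n : nat) : F :=
  \prod_(i < n) (x + i%:R).

Lemma rising0 (F : pzSemiRingType) (x : F) : rising x 0 = 1.
Proof. exact: big_ord0. Qed.

Lemma risingS (F : pzSemiRingType) (x : F) n :
  rising x n.+1 = rising x n * (x + n%:R).
Proof. exact: big_ord_recr. Qed.

Lemma risingSl (F : pzSemiRingType) (x : F) n :
  rising x n.+1 = x * rising (x + 1) n.
Proof.
rewrite /rising big_ord_recl addr0; congr (_ * _).
by apply: eq_bigr => i _; rewrite lift0 -addrA -natr1 [1 + _]addrC.
Qed.

Lemma risingD (F : pzSemiRingType) (x : F) m n :
  rising x (m + n) = rising x m * rising (x + m%:R) n.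
Proof.
elim: n => [|n IH]; first by rewrite addn0 rising0 mulr1.
by rewrite addnS !risingS IH natrD -mulrA addrA.
Qed.

Lemma rising_gt0 (F : numDomainType) (x : F) n : 0 < x -> 0 < rising x n.
Proof. by move=> x0; apply: prodr_gt0 => i _; rewrite ltr_wpDr. Qed.

Lemma rising_ge0 (F : numDomainType) (x : F) n : 0 <= x -> 0 <= rising x n.
Proof. by move=> x0; apply: prodr_ge0 => i _; rewrite addr_ge0. Qed.

Lemma ler_rising (F : numDomainType) (x y : F) n :
  0 <= x -> x <= y -> rising x n <= rising y n.
Proof. by move=> x0 xy; apply: ler_prod => i _; rewrite addr_ge0// lerD2r. Qed.

Lemma rising_ge1 (F : numDomainType) (x : F) n : 1 <= x -> 1 <= rising x n.
Proof.
move=> x1; elim: n => [|n IH]; first by rewrite rising0.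
by rewrite risingS mulr_ege1// ler_wpDr.
Qed.

Lemma rising_ge_arg (F : numDomainType) (x : F) n : 0 <= x -> x <= rising x n.+1.
Proof. by move=> x0; rewrite risingSl ler_peMr// rising_ge1// lerDr. Qed.

Lemma rising_fact (F : pzSemiRingType) (k n : nat) :
  (k`!)%:R * rising (k.+1%:R : F) n = ((k + n)`!)%:R.
Proof.
elim: n => [|n IH]; first by rewrite rising0 mulr1 addn0.
by rewrite risingS mulrA IH -natrD -natrM addSn addnS factS mulnC.
Qed.

(** Reverse the product: [x - n + i] is the opposite of [1 - x + (n - 1 - i)]. *)
Lemma rising_opp (F : comNzRingType) (x : F) n :
  rising (x - n%:R) n = (-1) ^+ n * rising (1 - x) n.
Proof.
elim: n => [|n IH] in x *; first by rewrite !rising0 mulr1.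
rewrite risingSl risingS (_ : x - n.+1%:R + 1 = x - n%:R) ?IH.
  by rewrite exprS -natr1; ring.
by rewrite -natr1; ring.
Qed.

(** * Finite differences and shifted Legendre coefficients *)

Lemma fin_diffS (F : comNzRingType) n (g : nat -> F) :
  \sum_(k < n.+2) (-1) ^+ k * 'C(n.+1, k)%:R * g k =
  \sum_(k < n.+1) (-1) ^+ k * 'C(n, k)%:R * (g k - g k.+1).
Proof.
pose t k := (-1) ^+ k * 'C(n, k)%:R * g k.
(* The term [k = n + 1] may be added because ['C(n, n.+1)] is 0; Pascal's rule then does the
   rest. *)
have tE : \sum_(k < n.+1) t k = g 0 + \sum_(k < n.+1) t k.+1.
  transitivity (\sum_(k < n.+2) t k).
    by rewrite [RHS]big_ord_recr /= /t bin_small// mulr0 mul0r addr0.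
  by rewrite big_ord_recl /t bin0 !mul1r.
under [RHS]eq_bigr do rewrite mulrBr.
rewrite sumrB -/t tE big_ord_recl bin0 !mul1r -addrA; congr (_ + _).
rewrite -sumrB; apply: eq_bigr => k _.
by rewrite lift0 binS natrD /t exprS; ring.
Qed.

(** One difference step turns [rising x j.+1] into [- j.+1] times [rising (x + 1) j], so the degree
    drops by one each time. *)
Lemma fin_diff_rising (F : comNzRingType) n j (x : F) : (j <= n)%N ->
  \sum_(k < n.+1) (-1) ^+ k * 'C(n, k)%:R * rising (x + k%:R) j =
  if j == n then (-1) ^+ n * (n`!)%:R else 0.
Proof.
elim: n j x => [|n IH] [|j] x //.
- by rewrite big_ord1 rising0 !mulr1.
- move=> _; rewrite (fin_diffS n (fun k => rising (x + k%:R) 0)) big1// => i _.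
  by rewrite !rising0 subrr mulr0.
rewrite ltnS eqSS => jn.
rewrite (fin_diffS n (fun k => rising (x + k%:R) j.+1)).
transitivity (- j.+1%:R * \sum_(k < n.+1) (-1) ^+ k * 'C(n, k)%:R *
    rising (x + 1 + k%:R) j).
  rewrite mulr_sumr; apply: eq_bigr => k _.
  rewrite risingSl risingS -!natr1.
  rewrite (_ : x + k%:R + 1 = x + 1 + k%:R); last by ring.
  rewrite (_ : x + (k%:R + 1) = x + 1 + k%:R); last by ring.
  by ring.
rewrite IH//; case: eqP => [->|_]; last by rewrite mulr0.
by rewrite factS exprS natrM -!natr1; ring.
Qed.

Lemma sum_inv_linear (F : numFieldType) n (z : F) : 0 <= z ->
  \sum_(k < n.+1) (-1) ^+ k * 'C(n, k)%:R / (z + k%:R + 1) =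
  (n`!)%:R / rising (z + 1) n.+1.
Proof.
elim: n z => [|n IH] z z0.
  by rewrite big_ord1 risingS rising0 !mulr1 !mul1r !addr0.
rewrite (fin_diffS n (fun k => (z + k%:R + 1)^-1)).
under eq_bigr do rewrite mulrBr.
rewrite sumrB IH//.
under eq_bigr => k _ do rewrite -natr1 addrA (addrAC z).
rewrite IH ?addr_ge0// (risingSl _ n.+1) (risingSl (z + 1) n) risingS.
have z1 : 0 < z + 1 by rewrite ltr_wpDl.
have r0 : rising (z + 1 + 1) n != 0 by rewrite gt_eqF// rising_gt0// addr_gt0.
have a0 : z + 1 != 0 by rewrite gt_eqF.
have b0 : z + 1 + 1 + n%:R != 0 by rewrite gt_eqF// ltr_wpDr// addr_gt0.
rewrite factS natrM -!natr1; field.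
by rewrite r0 a0 b0.
Qed.

Definition legendre_coef (F : pzRingType) (n k : nat) : F :=
  'C(n, k)%:R * 'C(n + k, k)%:R * (-1) ^+ (n + k).

(** ['C(n + k, k)] is a polynomial of degree [n] in [k], so sums against these coefficients become
    n-th finite differences. *)
Lemma legendre_coefE (F : numFieldType) n k : (k <= n)%N ->
  legendre_coef F n k =
  (-1) ^+ n / n`!%:R * ((-1) ^+ k * 'C(n, k)%:R * rising (1 + k%:R) n).
Proof.
move=> kn; rewrite /legendre_coef exprD.
have nf i : (i`!%:R : F) != 0 by rewrite pnatr_eq0 -lt0n fact_gt0.
have -> : 'C(n + k, k)%:R = rising (1 + k%:R : F) n / n`!%:R.
  apply: (mulIf (nf n)); apply: (mulIf (nf k)); rewrite mulfVK//.
  rewrite addrC natr1 [RHS]mulrC rising_fact -!natrM [(k + n)%N]addnC.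
  by rewrite -(bin_fact (leq_addl n k)) addnK [(k`! * _)%N]mulnC mulnA.
by ring.
Qed.

(** The value at 1 of the shifted Legendre polynomial; it gives [euler_gamma] the coefficient 1 in
    the linear form. *)
Lemma sum_legendre_coef (F : numFieldType) n :
  \sum_(k < n.+1) legendre_coef F n k = 1.
Proof.
under eq_bigr => k _ do rewrite (legendre_coefE F (ltn_ord k : k <= n)%N).
rewrite -mulr_sumr fin_diff_rising// eqxx mulrACA -exprD -signr_odd oddD addbb.
by rewrite mul1r mulVf// pnatr_eq0 -lt0n fact_gt0.
Qed.

Lemma sum_rising_div (F : numFieldType) n j (z : F) : (j <= n)%N -> 0 <= z ->
  \sum_(k < n.+1) (-1) ^+ k * 'C(n, k)%:R * rising (1 + k%:R) j / (z + k%:R + 1)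
  = (-1) ^+ j * n`!%:R * rising (z - j%:R + 1) j / rising (z + 1) n.+1.
Proof.
move=> + z0; elim: j => [_|j IH jn].
  under eq_bigr do rewrite rising0 mulr1.
  by rewrite sum_inv_linear// rising0 mulr1 mul1r.
(* 1 + k + j = (z + k + 1) - (z - j); the first part is a vanishing n-th finite
   difference. *)
transitivity (\sum_(k < n.+1) (-1) ^+ k * 'C(n, k)%:R * rising (1 + k%:R) j
  - (z - j%:R) * \sum_(k < n.+1)
     (-1) ^+ k * 'C(n, k)%:R * rising (1 + k%:R : F) j / (z + k%:R + 1)).
  rewrite mulr_sumr -sumrB; apply: eq_bigr => k _; rewrite risingS.
  have zk0 : z + k%:R + 1 != 0 by rewrite gt_eqF// ltr_wpDl// addr_ge0.
  by field.
rewrite IH ?fin_diff_rising 1?ltnW// ltn_eqF// sub0r.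
rewrite (risingSl _ j) -natr1 (_ : z - (j%:R + 1) + 1 = z - j%:R); last by ring.
by rewrite exprS; ring.
Qed.

Lemma legendre_partial_fraction (F : numFieldType) n (z : F) : 0 <= z ->
  \sum_(k < n.+1) legendre_coef F n k / (z + k%:R + 1) =
  rising (z - n%:R + 1) n / rising (z + 1) n.+1.
Proof.
move=> z0.
transitivity ((-1) ^+ n / n`!%:R * \sum_(k < n.+1)
    (-1) ^+ k * 'C(n, k)%:R * rising (1 + k%:R : F) n / (z + k%:R + 1)).
  rewrite mulr_sumr; apply: eq_bigr => k _.
  by rewrite (legendre_coefE F (ltn_ord k : k <= n)%N) -!mulrA.
rewrite sum_rising_div// -!mulrA mulrCA signrMK.
by rewrite mulKf ?pnatr_eq0 -?lt0n ?fact_gt0.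
Qed.

(** * Terms of the series psi: increments, sign, decay, monotonicity *)

(* The index k > n of the series psi_n is shifted to k = n + j + 1. *)
Definition psi_term (F : unitRingType) (n : nat) (z : F) (j : nat) : F :=
  rising (z - n%:R) n.+1 / ((n + j.+1)%:R * rising (z + 1 + j%:R) n.+1).

Lemma psi_term_diff (F : numFieldType) n (z : F) j : 0 <= z ->
  psi_term n (z + 1) j - psi_term n z j = rising (z - n%:R + 1) n *
    ((rising (z + 1 + j%:R) n.+1)^-1 - (rising (z + 1 + j.+1%:R) n.+1)^-1).
Proof.
move=> z0; rewrite /psi_term.
have z1 : 0 < z + 1 by rewrite ltr_wpDl.
rewrite (_ : z + 1 - n%:R = z - n%:R + 1); last by ring.
rewrite (_ : z + 1 + 1 + j%:R = z + 1 + j%:R + 1); last by ring.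
rewrite (_ : z + 1 + j.+1%:R = z + 1 + j%:R + 1); last by rewrite -natr1 addrA.
rewrite [rising (z - n%:R + 1) n.+1]risingS (risingSl (z - n%:R)).
rewrite (risingSl (z + 1 + j%:R)) [rising (z + 1 + j%:R + 1) n.+1]risingS.
rewrite addnS -natr1 natrD.
have zj : 0 < z + 1 + j%:R by rewrite ltr_wpDr.
have zj1 : 0 < z + 1 + j%:R + 1 by rewrite addr_gt0.
have zjn : 0 < z + 1 + j%:R + 1 + n%:R by rewrite ltr_wpDr.
have nj : 0 < n%:R + j%:R + 1 :> F by rewrite ltr_wpDl// addr_ge0.
have := rising_gt0 n zj1; move: (rising _ n) (rising _ n) => p q q0.
field.
by rewrite !gt_eqF.
Qed.

(** For [n = w + m] and [z = w + t] the numerator is [(t - m)_m (t)_(w+1)]. When [0 <= t <= 1] its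
    first [m] factors are nonpositive, and reflecting them brings out the sign. *)
Lemma psi_term_signE (F : comUnitRingType) m w (t : F) j :
  (-1) ^+ m * psi_term (w + m) (w%:R + t) j = rising (1 - t) m * rising t w.+1 /
    ((w + m + j.+1)%:R * rising (w%:R + t + 1 + j%:R) (w + m).+1).
Proof.
rewrite /psi_term mulrA; congr (_ / _).
rewrite natrD (_ : w%:R + t - _ = t - m%:R); last by ring.
by rewrite -addSn addnC risingD subrK rising_opp mulrA signrMK.
Qed.

Lemma psi_term_sign_ge0 (F : numFieldType) m w (t : F) j : 0 <= t <= 1 ->
  0 <= (-1) ^+ m * psi_term (w + m) (w%:R + t) j.
Proof.
case/andP=> t0 t1; rewrite psi_term_signE divr_ge0//.
  by rewrite mulr_ge0// rising_ge0// subr_ge0.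
by rewrite mulr_ge0// rising_ge0// !addr_ge0.
Qed.

(** With [s = t + w + 1], [N = w + m + 1] and [y = j], passing from [w] to [w + 1] multiplies the
    term by [s (N + y) (s + y) / ((N + y + 1) (s + y + N) (s + y + N + 1))]. *)
Lemma psi_term_quarter (F : realFieldType) m w (t : F) j : 0 <= t <= 1 ->
  (-1) ^+ m * psi_term (w.+1 + m) (w.+1%:R + t) j <=
  4^-1 * ((-1) ^+ m * psi_term (w + m) (w%:R + t) j).
Proof.
case/andP=> t0 t1; rewrite !psi_term_signE.
pose s := t + w%:R + 1; set N : F := (w + m)%:R + 1.
have m0 : 0 <= m%:R :> F by [].
have j0 : 0 <= j%:R :> F by [].
have w0 : 0 <= w%:R :> F by [].
have s0 : 0 < s by rewrite /s; lra.
have sN : s <= N + 1 by rewrite /s /N natrD; lra.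
have N0 : 0 < N by rewrite /N natrD; lra.
have -> : (w.+1 + m + j.+1)%:R = N + j%:R + 1 :> F.
  by rewrite !addSn addnS -!natr1 natrD /N; ring.
have -> : (w + m + j.+1)%:R = N + j%:R :> F.
  by rewrite addnS -!natr1 natrD /N; ring.
rewrite (_ : w.+1%:R + t + 1 + j%:R = s + j%:R + 1); last first.
  by rewrite -[w.+1%:R]natr1 /s; ring.
rewrite (_ : w%:R + t + 1 + j%:R = s + j%:R); last by rewrite /s; ring.
rewrite addSn (risingS t w.+1) (_ : t + _ = s); last by rewrite -[w.+1%:R]natr1 /s; ring.
set A := rising (1 - t) m * rising t w.+1.
rewrite (_ : rising _ m * _ = A * s); last by rewrite /A; ring.
have A0 : 0 <= A by rewrite mulr_ge0// rising_ge0// subr_ge0.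
have sj0 : 0 < s + j%:R by lra.
have q0 : 0 < rising (s + j%:R + 1) (w + m) by rewrite rising_gt0//; lra.
have -> : rising (s + j%:R) (w + m).+1 = (s + j%:R) * rising (s + j%:R + 1) (w + m).
  by rewrite risingSl.
have -> : rising (s + j%:R + 1) (w + m).+2 = rising (s + j%:R + 1) (w + m) *
   ((s + j%:R + N) * (s + j%:R + N + 1)).
  by rewrite !risingS -[(w + m).+1%:R]natr1 /N; ring.
move: (rising _ (w + m)) q0 => q q0.
move: A A0 (j%:R) j0 sj0 => A A0 y y0 sy0.
clearbody s N.
rewrite -subr_ge0.
have -> : 4^-1 * (A / ((N + y) * ((s + y) * q))) -
    A * s / ((N + y + 1) * (q * ((s + y + N) * (s + y + N + 1)))) =
    A * ((N + y + 1) * ((s + y + N) * (s + y + N + 1)) -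
      4 * s * (N + y) * (s + y)) /
    (4 * (N + y) * (s + y) * q * (N + y + 1) * ((s + y + N) * (s + y + N + 1))).
  field.
  by rewrite !gt_eqF//; lra.
rewrite divr_ge0//; last by rewrite !mulr_ge0//; lra.
rewrite mulr_ge0// subr_ge0.
apply: (@le_trans _ _ ((s + y + N) ^+ 2 * (s + y))).
  rewrite ler_pM2r//. (* AM-GM: 4 s (N + y) <= (s + N + y)^2 *)
  have : 0 <= (s - (N + y)) ^+ 2 by exact: sqr_ge0.
  by rewrite !expr2; lra.
(* The remaining comparison [s + y <= N + y + 1] follows from [t <= 1]. *)
rewrite [leRHS]mulrC expr2 ler_pM//; [by rewrite mulr_ge0//; lra|lra| |lra].
by rewrite ler_wpM2l//; lra.
Qed.

(** Up to a positive constant the term is a product of factors [1 - (n + j + 1) / (x + 1 + j + i)],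
    nonnegative and increasing for [x >= n]. *)
Lemma ler_psi_term (F : realFieldType) n (z z' : F) j :
  n%:R <= z -> z <= z' -> psi_term n z j <= psi_term n z' j.
Proof.
move=> nz zz'.
have E (x : F) : psi_term n x j = (n + j.+1)%:R^-1 *
    \prod_(i < n.+1) ((x - n%:R + i%:R) / (x + 1 + j%:R + i%:R)).
  by rewrite prodf_div /psi_term invfM mulrCA mulrC.
rewrite !E ler_wpM2l ?invr_ge0//; apply: ler_prod => i _.
have i0 : 0 <= i%:R :> F by [].
have j0 : 0 <= j%:R :> F by [].
have n0 : 0 <= n%:R :> F by [].
apply/andP; split; first by rewrite divr_ge0//; lra.
rewrite ler_pdivrMr; last by lra.
rewrite mulrAC ler_pdivlMr; last by lra.
by nra.
Qed.

(** Both factors of the denominator are at least [j + 1]; the telescoping bound serves the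
    convergence of [psi]. *)
Lemma psi_term_denom_ge (F : realFieldType) n (z : F) j : 0 <= z ->
  ((n + j.+1)%:R * rising (z + 1 + j%:R) n.+1)^-1 <=
  2 * (j.+1%:R^-1 - j.+2%:R^-1).
Proof.
move=> z0; have j0 : 0 <= j%:R :> F by [].
apply: (@le_trans _ _ (j.+1%:R ^+ 2)^-1).
  rewrite lef_pV2 ?posrE; last first.
  - by rewrite exprn_gt0.
  - by rewrite mulr_gt0 ?rising_gt0 ?ltr0n ?addnS//; lra.
  rewrite expr2 ler_pM// ?ler_nat ?leq_addl//.
  apply: le_trans (rising_ge_arg _ _); last by lra.
  by rewrite -natr1; lra.
rewrite -[j.+2%:R]natr1 -[j.+1%:R]natr1; set y := j%:R.
have -> : 2 * ((y + 1)^-1 - (y + 1 + 1)^-1) = 2 / ((y + 1) * (y + 1 + 1)).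
  by field; rewrite !gt_eqF// /y; lra.
rewrite ler_pdivlMr; last by rewrite mulr_gt0// /y; lra.
rewrite ler_pdivrMl; last by rewrite exprn_gt0// /y; lra.
by rewrite expr2 /y; nra.
Qed.

(** * Harmonic numbers and Euler's constant *)

(* The sum stops at n - 1, so that harm k.+1 is H_k. *)
Definition harm (R : realType) (n : nat) : R := \sum_(1 <= k < n) k%:R^-1.

Lemma harmS (R : realType) n : harm R n.+2 = harm R n.+1 + n.+1%:R^-1.
Proof. by rewrite /harm big_nat_recr. Qed.

Lemma harmD (R : realType) m n : (0 < m)%N ->
  harm R (m + n) - harm R m = \sum_(i < n) (m + i)%:R^-1.
Proof.
move=> m0; rewrite /harm (@big_cat_nat _ _ _ m) ?leq_addr//= addrAC subrr add0r.
by rewrite -{1}[m]add0n big_addn addKn big_mkord; under eq_bigr do rewrite addnC.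
Qed.

(** This bound and the next come from [ln (1 + x) <= x], at [x = 1/(n+1)] and [x = -1/(n+2)]. *)
Lemma ln_succ_le (R : realType) n :
  ln n.+2%:R <= ln n.+1%:R + n.+1%:R^-1 :> R.
Proof.
have n1 : 0 < n.+1%:R :> R by [].
have -> : n.+2%:R = n.+1%:R * (1 + n.+1%:R^-1) :> R.
  by rewrite mulrDr mulr1 mulfV ?gt_eqF// natr1.
have i0 : 0 < n.+1%:R^-1 :> R by rewrite invr_gt0.
rewrite lnM ?posrE ?addr_gt0//.
by rewrite lerD2l le_ln1Dx// (lt_trans _ i0).
Qed.

Lemma ln_succ_ge (R : realType) n :
  ln n.+1%:R + n.+2%:R^-1 <= ln n.+2%:R :> R.
Proof.
have n1 : 0 < n.+2%:R :> R by [].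
have E : 1 - n.+2%:R^-1 = n.+1%:R / n.+2%:R :> R.
  by rewrite -[n.+2%:R]natr1; field; rewrite gt_eqF// ltr_wpDr//.
have -> : n.+1%:R = n.+2%:R * (1 - n.+2%:R^-1) :> R.
  by rewrite E mulrCA mulfV ?mulr1 ?gt_eqF.
have i1 : n.+2%:R^-1 < 1 :> R by rewrite invf_lt1// ltr1n.
rewrite lnM ?posrE ?subr_gt0// -addrA gerDl -lerBrDr sub0r.
by rewrite le_ln1Dx// ltrN2.
Qed.

(** The sequence here is [H_(n-1) - ln n], nondecreasing and bounded by 1; the one defining
    [euler_gamma] exceeds it by [1/n]. *)
Lemma cvg_harm_ln (R : realType) :
  harm R n - ln n%:R @[n --> \oo] --> euler_gamma R.
Proof.
pose e n := harm R n - ln n%:R.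
have e_cvg : cvgn e.
  have h : cvgn [sequence e n.+1]_n.
    apply: nondecreasing_is_cvgn.
      apply/nondecreasing_seqP => n; rewrite /e/= harmS.
      by have := ln_succ_le R n; move: (n.+1%:R^-1) => x; lra.
    exists 1 => _ [n _ <-] /=; rewrite /e lerBlDr.
    apply: (@le_trans _ _ (harm R n.+2)); first by rewrite harmS lerDl invr_ge0.
    elim: n => [|n IH]; first by rewrite harmS /harm big_geq// add0r invr1 ln1 addr0.
    by rewrite harmS (le_trans (lerD IH (lexx _)))// -addrA lerD2l ln_succ_ge.
  by apply/cvg_ex; exists (limn [sequence e n.+1]_n); rewrite -cvg_shiftS.
have u_cvg : harm R n.+1 - ln n%:R @[n --> \oo] --> limn e.
  rewrite -cvg_shiftS /=.
  have -> : (fun n => harm R n.+2 - ln n.+1%:R) = [sequence e n.+1]_n \+ harmonic.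
    by apply/funext => n /=; rewrite harmS /e addrAC.
  rewrite -[limn e]addr0; apply: cvgD; last exact: cvg_harmonic.
  by rewrite cvg_shiftS.
have -> : euler_gamma R = limn e by rewrite /euler_gamma; apply: cvg_lim.
exact: e_cvg.
Qed.

(** * The function psi and its values at integers *)

Definition psi (R : realType) (n : nat) (z : R) : R :=
  limn (series (psi_term n z)).

Lemma is_cvg_series_psi_term (R : realType) n (z : R) : 0 <= z ->
  cvgn (series (psi_term n z)).
Proof.
move=> z0; pose b j : R := ((n + j.+1)%:R * rising (z + 1 + j%:R) n.+1)^-1.
have b0 j : 0 <= b j.
  by rewrite invr_ge0 mulr_ge0// rising_ge0// !addr_ge0.
suff b_cvg : cvgn (series b).
  have := @is_cvg_seriesZ _ b (rising (z - n%:R) n.+1) b_cvg.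
  by rewrite (_ : _ *: b = psi_term n z).

apply: nondecreasing_is_cvgn; first exact: nondecreasing_series.
exists 2 => _ [K _ <-]; rewrite /series/=.
apply: (@le_trans _ _ (2 * \sum_(0 <= j < K) (j.+1%:R^-1 - j.+2%:R^-1))).
  by rewrite mulr_sumr; apply: ler_sum => j _; exact: psi_term_denom_ge.
under eq_bigr do rewrite -opprB.
rewrite sumrN telescope_sumr// opprB invr1 ler_piMr// lerBlDr lerDl invr_ge0//.
Qed.

Lemma cvg_rising_inv (R : realType) n (x : R) : 0 < x ->
  (rising (x + j%:R) n.+1)^-1 @[j --> \oo] --> 0.
Proof.
move=> x0.
rewrite -cvg_shiftS/=.
apply: (@squeeze_cvgr _ _ _ _ (fun=> 0) (@harmonic R)).
- near=> j; apply/andP; split.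
    by rewrite invr_ge0 rising_ge0// addr_ge0// ltW.
  rewrite /= lef_pV2 ?posrE ?rising_gt0 ?addr_gt0//.
  apply: le_trans (rising_ge_arg _ _); first by rewrite lerDr ltW.
  by rewrite addr_ge0// ltW.
- exact: cvg_cst.
- exact: cvg_harmonic.
Unshelve. all: by end_near. Qed.

Lemma psi_diff (R : realType) n (z : R) : 0 <= z ->
  psi n (z + 1) - psi n z =
  \sum_(k < n.+1) legendre_coef R n k / (z + k%:R + 1).
Proof.
move=> z0; rewrite legendre_partial_fraction//.
have z1 : 0 < z + 1 by rewrite ltr_wpDl.
rewrite /psi -limB; [|exact/is_cvg_series_psi_term/ltW|exact: is_cvg_series_psi_term].
apply: cvg_lim => //.
pose D j : R := (rising (z + 1 + j%:R) n.+1)^-1.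
have -> : (series (psi_term n (z + 1)) - series (psi_term n z))%R =
    (fun K => rising (z - n%:R + 1) n * (D 0 - D K)).
  apply/funext => K; rewrite /series /= fctE -sumrB.
  under eq_bigr do rewrite psi_term_diff//.
  rewrite -mulr_sumr; congr (_ * _).
  rewrite -[RHS]opprB -(telescope_sumr D)// -sumrN.
  by apply: eq_bigr => j _; rewrite opprB.
rewrite [X in _ --> X](_ : _ = rising (z - n%:R + 1) n * (D 0 - 0)); last first.
  by rewrite subr0 /D addr0.
apply: cvgMl_tmp; apply: cvgB; first exact: cvg_cst.
exact: cvg_rising_inv.
Qed.

Lemma psi_nat (R : realType) n a :
  psi n (a%:R : R) =
  \sum_(k < n.+1) legendre_coef R n k * (harm R (a + k).+1 - harm R k.+1).
Proof.
elim: a => [|a IH].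
  rewrite big1 => [|k _]; last by rewrite add0n subrr mulr0.
  rewrite /psi (_ : psi_term _ _ = 0); last first.
    (* At [z = 0] the numerator [(-n)_(n+1)] contains the factor 0. *)
    by apply/funext => j; rewrite /psi_term risingS sub0r addNr mulr0 mul0r.
  rewrite (_ : series 0 = cst 0) ?lim_cst//.
  by apply/funext => K; rewrite /series/= big1.
rewrite -natr1 -[LHS](subrK (psi n a%:R)) psi_diff// IH -big_split/=.
apply: eq_bigr => k _; rewrite -mulrDr addSn harmS -[(a + k).+1%:R]natr1 natrD.
by move: (_^-1) => x; ring.
Qed.

Lemma ler_psi (R : realType) n (z z' : R) :
  n%:R <= z -> z <= z' -> psi n z <= psi n z'.
Proof.
move=> nz zz'; have z0 : 0 <= z by exact: le_trans nz.
apply: lim_series_le; try exact: is_cvg_series_psi_term.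
  by apply: is_cvg_series_psi_term; exact: le_trans zz'.
by move=> j; exact: ler_psi_term.
Qed.

(** * Averages of psi over a grid *)

Lemma cvg_sum_ord (R : realType) n (f : 'I_n -> nat -> R) (l : 'I_n -> R) :
  (forall k, f k a @[a --> \oo] --> l k) ->
  \sum_(k < n) f k a @[a --> \oo] --> \sum_(k < n) l k.
Proof. by move=> fl; apply: cvg_big => //; exact: add_continuous. Qed.

Lemma cvg_muln_addn (N k : nat) : (0 < N)%N -> (N * (a + k))%N @[a --> \oo] --> \oo.
Proof.
move=> N0.
exact: (cvg_comp (addn^~ k) (muln N) (@cvg_addnr k) (@cvg_mulnl N N0)).
Qed.

(* The two sides have the same increment in a, and their difference tends to 0
   as a grows because psi is monotone there. *)
Lemma psi_average (R : realType) n a N : (0 < N)%N ->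
  N%:R^-1 * \sum_(i < N) psi n (a%:R + i%:R / N%:R : R) =
  \sum_(k < n.+1) legendre_coef R n k *
    (harm R (N * (a + k.+1)) - ln N%:R - harm R k.+1).
Proof.
move=> N0; have NR0 : 0 < N%:R :> R by rewrite ltr0n.
have iN (i : 'I_N) : 0 <= (i%:R / N%:R : R) <= 1.
  apply/andP; split; first by rewrite divr_ge0.
  by rewrite ler_pdivrMr// mul1r ler_nat ltnW.
pose A a : R := N%:R^-1 * \sum_(i < N) psi n (a%:R + i%:R / N%:R).
pose B a : R := \sum_(k < n.+1) legendre_coef R n k *
  (harm R (N * (a + k.+1)) - ln N%:R - harm R k.+1).
(* By [psi_diff] the increment of [A] is a double sum of [c_k / (N (b + k + 1) + i)]; for each [k]
   the sum over [i] is a difference of two values of [harm]. *)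
have AB b : A b.+1 - A b = B b.+1 - B b.
  rewrite -mulrBr -!sumrB.
  transitivity (N%:R^-1 * \sum_(i < N) \sum_(k < n.+1)
      legendre_coef R n k / (b%:R + i%:R / N%:R + k%:R + 1) : R).
    congr (_ * _); apply: eq_bigr => i _.
    rewrite -psi_diff; last by rewrite addr_ge0//; case/andP: (iN i).
    by rewrite -natr1 addrAC.
  rewrite exchange_big/= mulr_sumr; apply: eq_bigr => k _.
  rewrite -mulr_sumr mulrCA -mulrBr; congr (_ * _).
  rewrite addSn -addnS mulnDr (_ : N * k.+2 = N * k.+1 + N)%N; last first.
    by rewrite mulnS addnC.
  rewrite addnA -mulnDr.
  have := @harmD R (N * (b + k.+1)) N; rewrite muln_gt0 N0 addnS => /(_ isT) h.
  rewrite [RHS](_ : _ = harm R (N * (b + k).+1 + N) - harm R (N * (b + k).+1));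
    last by ring.
  rewrite h mulr_sumr; apply: eq_bigr => i _.
  rewrite -invfM natrD natrM -natr1 natrD; congr (_^-1).
  by field; rewrite gt_eqF.
have ABconst b : A b - B b = A 0 - B 0.
  elim: b => // b <-; apply/eqP; rewrite subr_eq addrAC -subr_eq; apply/eqP.
  by have := AB b; lra.
suff AB0 : A b - B b @[b --> \oo] --> (0 : R).
  have : A b - B b @[b --> \oo] --> A 0 - B 0.
    by under eq_fun do rewrite ABconst; exact: cvg_cst.
  move=> /(cvg_unique (@Rhausdorff R) AB0) h.
  by have := ABconst a; rewrite -h => /eqP; rewrite subr_eq0 => /eqP.
pose e j : R := harm R j - ln j%:R.
(* The correction to [psi n b] tends to 0, since both values of [e] tend to [euler_gamma]. *)
have BE b : B b = psi n b%:R - \sum_(k < n.+1) legendre_coef R n k *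
    (e (b + k.+1)%N - e (N * (b + k.+1))%N).
  rewrite psi_nat -sumrB; apply: eq_bigr => k _; rewrite -mulrBr; congr (_ * _).
  rewrite /e natrM lnM ?posrE ?addnS//.
  by ring.
have -> : (fun b => A b - B b) = (fun b => A b - psi n b%:R) \+
   (fun b => \sum_(k < n.+1) legendre_coef R n k *
    (e (b + k.+1)%N - e (N * (b + k.+1))%N)).
  by apply/funext => b /=; rewrite BE opprB; ring.
rewrite -[X in _ --> X]addr0; apply: cvgD; last first.
  rewrite [X in _ --> X](_ : _ = \sum_(k < n.+1) legendre_coef R n k *
      (euler_gamma R - euler_gamma R)); last first.
    by rewrite big1// => k _; rewrite subrr mulr0.
  apply: (@cvg_sum_ord R n.+1 (fun k b => legendre_coef R n k *
    (e (b + k.+1)%N - e (N * (b + k.+1))%N))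
    (fun k => legendre_coef R n k * (euler_gamma R - euler_gamma R))) => k.
  apply: cvgMl_tmp; apply: cvgB.
    exact: (cvg_comp (addn^~ k.+1) e (@cvg_addnr k.+1) (@cvg_harm_ln R)).
  exact: (cvg_comp (fun a => N * (a + k.+1))%N e
    (@cvg_muln_addn N k.+1 N0) (@cvg_harm_ln R)).
(* For [b >= n] monotonicity puts [A b - psi n b] between 0 and one increment of [psi], which tends
   to 0. *)
apply: (@squeeze_cvgr _ _ _ _ (fun=> 0)
  (fun b => \sum_(k < n.+1) legendre_coef R n k / (b%:R + k%:R + 1))).
- near=> b.
  have nb : n%:R <= b%:R :> R by rewrite ler_nat; near: b; exact: nbhs_infty_ge.
  rewrite -psi_diff//.
  have psi_cst (x : R) : x = N%:R^-1 * \sum_(i < N) x.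
    by rewrite sumr_const card_ord -(mulr_natl x) mulKf// gt_eqF.
  rewrite subr_ge0 lerD2r {1}(psi_cst (psi n b%:R)) (psi_cst (psi n (b%:R + 1))).
  rewrite /A !ler_pM2l ?invr_gt0//; apply/andP; split; apply: ler_sum => i _.
    by apply: ler_psi => //; rewrite lerDl; case/andP: (iN i).
  apply: ler_psi; last by rewrite lerD2l; case/andP: (iN i).
  by rewrite (le_trans nb)// lerDl; case/andP: (iN i).
- exact: cvg_cst.
- rewrite [X in _ --> X](_ : _ = \sum_(k < n.+1) legendre_coef R n k * 0); last first.
    by rewrite big1// => k _; rewrite mulr0.
  apply: (@cvg_sum_ord R n.+1
    (fun k b => legendre_coef R n k / (b%:R + k%:R + 1))
    (fun k => legendre_coef R n k * 0)) => k.
  apply: cvgMl_tmp.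
  rewrite [X in X --> _](_ : _ = (harmonic (b + k)%N : R) @[b --> \oo]).
    exact: (cvg_comp (addn^~ k) (@harmonic R) (@cvg_addnr k) cvg_harmonic).
  by under eq_fun do rewrite -natrD natr1.
Unshelve. all: by end_near. Qed.

(** * Sign and decay of psi *)

Lemma psi_signE (R : realType) m w (t : R) : 0 <= t ->
  cvgn (series (fun j => (-1) ^+ m * psi_term (w + m) (w%:R + t) j)) /\
  (-1) ^+ m * psi (w + m) (w%:R + t) =
    limn (series (fun j => (-1) ^+ m * psi_term (w + m) (w%:R + t) j)).
Proof.
move=> t0.
have c := @is_cvg_series_psi_term R (w + m) (w%:R + t) (addr_ge0 (ler0n _ _) t0).
by split; [exact: (@is_cvg_seriesZ _ _ ((-1) ^+ m : R))|
           exact/esym/(@lim_seriesZ _ _ ((-1) ^+ m : R))].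
Qed.

Lemma psi_sign_quarter (R : realType) m w (t : R) : 0 <= t <= 1 ->
  (-1) ^+ m * psi (w.+1 + m) (w.+1%:R + t) <=
  4^-1 * ((-1) ^+ m * psi (w + m) (w%:R + t)).
Proof.
move=> t01; have /andP[t0 _] := t01.
have [c ->] := psi_signE m w t0; have [c' ->] := psi_signE m w.+1 t0.
have cz := @is_cvg_seriesZ _ _ (4^-1 : R) c.
have := @lim_seriesZ _ _ (4^-1 : R) c; rewrite /GRing.scale/= => <-.
by apply: lim_series_le => // j; exact: psi_term_quarter.
Qed.

(** Only the term [j = 0] is kept, the others being nonnegative. The factor [t (1 - t)] has a
    positive integral. *)
Lemma psi_sign_ge (R : realType) m w (t : R) : 0 <= t <= 1 ->
  ((w + m).+1%:R * rising (w%:R + 2) (w + m).+1)^-1 * (t * (1 - t)) <=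
  (-1) ^+ m * psi (w + m) (w%:R + t).
Proof.
move=> t01; have /andP[t0 t1] := t01; have [c ->] := psi_signE m w t0.
apply: (@le_trans _ _ (series (fun j =>
    (-1) ^+ m * psi_term (w + m) (w%:R + t) j) 1)); last first.
  apply: nondecreasing_cvgn_le c 1%N; apply: nondecreasing_series => j _ _.
  exact: psi_term_sign_ge0.
rewrite /series/= big_nat1 psi_term_signE addr0 addn1 mulrC.
have wt : 0 < w%:R + t + 1 by rewrite ltr_wpDl// addr_ge0.
have t10 : 0 <= 1 - t by rewrite subr_ge0.
apply: ler_pM.
- exact: mulr_ge0.
- by rewrite invr_ge0 mulr_ge0// rising_ge0// addr_ge0.
- rewrite mulrC ler_pM// ?rising_ge_arg//.
  case: m {c} => [|m]; last exact: rising_ge_arg.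
  by rewrite rising0 lerBlDr lerDl.
- have w2 : 0 < w%:R + 2 :> R by rewrite ltr_wpDl.
  rewrite lef_pV2 ?posrE; [|exact: mulr_gt0 (rising_gt0 _ w2)|
    exact: mulr_gt0 (rising_gt0 _ wt)].
  by rewrite ler_pM2l//; apply: ler_rising; [exact: ltW|lra].
Qed.

(** * Riemann sums and the linear form in gamma *)

(** This Riemann sum equals [1/6 - 1/(6 N^2)], which is exactly [1/8] at [N = 2]. *)
Lemma sum_grid (R : realType) N : (1 < N)%N ->
  8^-1 <= N%:R^-1 * \sum_(i < N) (i%:R / N%:R) * (1 - i%:R / N%:R) :> R.
Proof.
move=> N1; have N0 : 0 < N%:R :> R by rewrite ltr0n ltnW.
have NR2 : 2 <= N%:R :> R by rewrite ler_nat.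
have E M : \sum_(i < M) (i%:R / N%:R) * (1 - i%:R / N%:R) =
    M%:R * (M%:R - 1) * (3 * N%:R - 2 * M%:R + 1) / (6 * N%:R ^+ 2) :> R.
  elim: M => [|M IH]; first by rewrite big_ord0 !mul0r.
  rewrite big_ord_recr/= IH -natr1; field.
  by rewrite gt_eqF.
rewrite E -subr_ge0.
have -> : N%:R^-1 * (N%:R * (N%:R - 1) * (3 * N%:R - 2 * N%:R + 1) /
    (6 * N%:R ^+ 2)) - 8^-1 = (N%:R - 2) * (N%:R + 2) / (24 * N%:R ^+ 2) :> R.
  by field; rewrite gt_eqF.
apply: divr_ge0; first by apply: mulr_ge0; lra.
by rewrite mulr_ge0// exprn_ge0.
Qed.

(* Lnm's truncated subtraction is avoided by writing n = w + m. *)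
Definition gamma_form (R : realType) (m w : nat) : R :=
  (-1) ^+ m * (euler_gamma R + Lnm R (w + m) m -
    \sum_(k < (w + m).+1) legendre_coef R (w + m) k * harm R k.+1).

(** In [psi_average], [harm] minus the logarithm of its argument tends to gamma and [ln N] cancels,
    leaving the logarithms of [Lnm]. *)
Lemma cvg_gamma_form (R : realType) m w :
  N.+1%:R^-1 * (\sum_(i < N.+1) (-1) ^+ m * psi (w + m) (w%:R + i%:R / N.+1%:R))
    @[N --> \oo] --> gamma_form R m w.
Proof.
set n := (w + m)%N; pose e j : R := harm R j - ln j%:R.
have -> : (fun N => N.+1%:R^-1 *
    (\sum_(i < N.+1) (-1) ^+ m * psi n (w%:R + i%:R / N.+1%:R)) : R) =
   (fun N => (-1) ^+ m * \sum_(k < n.+1) legendre_coef R n k *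
    (e (N.+1 * (w + k.+1))%N + ln (w + k.+1)%:R - harm R k.+1)).
  apply/funext => N; rewrite -mulr_sumr mulrCA psi_average//; congr (_ * _).
  apply: eq_bigr => k _; congr (_ * _).
  by rewrite /e natrM lnM ?posrE ?addnS//; ring.
have -> : gamma_form R m w = (-1) ^+ m * \sum_(k < n.+1) legendre_coef R n k *
    (euler_gamma R + ln (w + k.+1)%:R - harm R k.+1).
  rewrite /gamma_form -/n; congr (_ * _).
  have {1}-> : euler_gamma R = \sum_(k < n.+1) legendre_coef R n k * euler_gamma R.
    by rewrite -mulr_suml sum_legendre_coef mul1r.
  rewrite /Lnm big_mkord -big_split/= -sumrB; apply: eq_bigr => k _.
  by rewrite /legendre_coef /n addnK addn1 addnS; ring.
apply: cvgMl_tmp; apply: (@cvg_sum_ord R n.+1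
  (fun k N => legendre_coef R n k *
    (e (N.+1 * (w + k.+1))%N + ln (w + k.+1)%:R - harm R k.+1))
  (fun k => legendre_coef R n k *
    (euler_gamma R + ln (w + k.+1)%:R - harm R k.+1))) => k.
apply: cvgMl_tmp; apply: cvgB; last exact: cvg_cst.
apply: cvgD; last exact: cvg_cst.
have wk : (0 < w + k.+1)%N by rewrite addnS.
have := cvg_comp (muln^~ (w + k.+1)%N) e (@cvg_mulnr _ wk) (@cvg_harm_ln R).
by rewrite -(@cvg_shiftS _ (fun N => e (N * (w + k.+1))%N)).
Qed.

Lemma grid_itv (R : realType) N (i : 'I_N.+1) : 0 <= (i%:R / N.+1%:R : R) <= 1.
Proof.
apply/andP; split; first by rewrite divr_ge0.
by rewrite ler_pdivrMr// mul1r ler_nat ltnW.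
Qed.

(** Positivity alone could be lost in the limit, hence the lower bound [C / 8], which does not
    depend on [N]. *)
Lemma gamma_form_gt0 (R : realType) m w : 0 < gamma_form R m w.
Proof.
set C : R := ((w + m).+1%:R * rising (w%:R + 2) (w + m).+1)^-1.
have C0 : 0 < C by rewrite invr_gt0 mulr_gt0 ?rising_gt0 ?ltr_wpDl.
apply: (@lt_le_trans _ _ (C / 8)); first by rewrite divr_gt0.
apply: (cvgr_to_ge (@cvg_gamma_form R m w)); near=> N.
apply: (@le_trans _ _ (N.+1%:R^-1 *
    \sum_(i < N.+1) C * ((i%:R / N.+1%:R) * (1 - i%:R / N.+1%:R)))).
  rewrite -mulr_sumr mulrCA ler_pM2l// sum_grid// ltnS.
  by near: N; exact: nbhs_infty_gt.
rewrite ler_pM2l ?invr_gt0//; apply: ler_sum => i _.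
exact/psi_sign_ge/grid_itv.
Unshelve. all: by end_near. Qed.

Lemma gamma_form_quarter (R : realType) m w :
  gamma_form R m w.+1 <= 4^-1 * gamma_form R m w.
Proof.
have c := @cvg_gamma_form R m w; have c' := @cvg_gamma_form R m w.+1.
apply: (ler_cvg_to c' (cvgMl_tmp c)); apply: nearW => N.
rewrite mulrCA ler_pM2l ?invr_gt0// mulr_sumr; apply: ler_sum => i _.
exact/psi_sign_quarter/grid_itv.
Qed.

Lemma gamma_form_decay (R : realType) m w j :
  gamma_form R m (w + j) <= 4^-1 ^+ j * gamma_form R m w.
Proof.
elim: j => [|j IH]; first by rewrite addn0 mul1r.
rewrite addnS (le_trans (gamma_form_quarter _ _ _))//.
by rewrite exprS -mulrA ler_pM2l// invr_gt0.
Qed.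

(** * Least common multiples and central binomial coefficients *)

Lemma dvdn_lcm_upto n k : (0 < k <= n)%N -> (k %| lcm_upto n)%N.
Proof.
case/andP=> k0 kn; rewrite /lcm_upto -big_filter; move: (mem_index_iota 1 n.+1 k).
rewrite ltnS k0 kn big_filter.
elim: (index_iota _ _) => //= x s IH; rewrite inE big_cons.
case/predU1P => [<-|/IH h]; first exact: dvdn_lcml.
exact: dvdn_trans h (dvdn_lcmr _ _).
Qed.

Lemma lcm_upto_dvd n M : (forall k, 0 < k <= n -> k %| M)%N -> (lcm_upto n %| M)%N.
Proof.
move=> h; rewrite /lcm_upto big_seq; elim/big_ind: _ => //.
  by move=> x y xM yM; rewrite dvdn_lcm xM yM.
by move=> k; rewrite mem_index_iota ltnS; exact: h.
Qed.

Lemma lcm_upto_gt0 n : (0 < lcm_upto n)%N.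
Proof.
rewrite /lcm_upto big_seq; elim/big_ind: _ => //.
  by move=> x y x0 y0; rewrite lcmn_gt0 x0 y0.
by move=> k; rewrite mem_index_iota => /andP[].
Qed.

Lemma prime_dvd_central_bin n p e : prime p -> (n < p ^ e <= n.*2)%N ->
  (p %| 'C(n.*2, n))%N.
Proof.
move=> pp /andP[npe pen].
have C0 : (0 < 'C(n.*2, n))%N by rewrite bin_gt0 -addnn leq_addl.
have e0 : (0 < e)%N by case: e npe pen => // ; rewrite expn0 ltnS leqn0 => /eqP ->.
(* In Legendre's formula the power p ^ e contributes 1 - 2 * 0. *)
suff : (0 < logn p 'C(n.*2, n))%N by rewrite logn_gt0 mem_primes pp C0.
have en : (e < n.*2.+1)%N by rewrite ltnS (leq_trans _ pen)// ltnW// ltn_expl// prime_gt1.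
have := congr1 (logn p) (bin_fact (leq_addl n n)).
rewrite addnn -addnn addnK addnn.
rewrite !lognM ?muln_gt0 ?fact_gt0 ?C0// !logn_fact//.
(* Terms with [k > n] vanish, so both Legendre sums get the same range. *)
have ext : (\sum_(1 <= k < n.+1) n %/ p ^ k = \sum_(1 <= k < n.*2.+1) n %/ p ^ k)%N.
  rewrite [RHS](@big_cat_nat _ _ _ n.+1)//=; last by rewrite ltnS -addnn leq_addl.
  rewrite [X in _ = (_ + X)%N]big1_seq ?addn0// => k /andP[_].
  rewrite mem_index_iota => /andP[nk _].
  by rewrite divn_small// (leq_trans nk)// ltnW// ltn_expl// prime_gt1.
rewrite ext addnn -[X in (_ + X)%N]muln2 big_distrl/= => h.
suff : (\sum_(1 <= k < n.*2.+1) n %/ p ^ k * 2 < \sum_(1 <= k < n.*2.+1) n.*2 %/ p ^ k)%N.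
  by rewrite -h; lia.
have le2 k : (n %/ p ^ k * 2 <= n.*2 %/ p ^ k)%N.
  by rewrite -muln2 leq_divRL ?expn_gt0 ?prime_gt0// mulnAC leq_mul2r leq_trunc_div orbT.
(* By [le2] the comparison holds term by term; it is strict at [k = e], where the left term is 0 and
   the right one positive. *)
rewrite !(@big_cat_nat _ _ _ e 1 n.*2.+1) ?(ltnW en)//=.
rewrite !(@big_ltn _ _ _ e n.*2.+1)//.
rewrite (divn_small npe) mul0n add0n.
rewrite -addnS leq_add ?leq_sum// -add1n leq_add ?leq_sum//.
by rewrite divn_gt0 ?expn_gt0 ?prime_gt0.
Qed.

(** Consider a prime power [p^e <= 2n]. Either [p^e <= n], or [p^(e-1) <= n] because [p >= 2], and
    the missing factor [p] divides the binomial coefficient. *)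
Lemma lcm_upto_double n : (lcm_upto n.*2 %| lcm_upto n * 'C(n.*2, n))%N.
Proof.
apply: lcm_upto_dvd => k /andP[k0 kn].
apply/(dvdn_partP _ k0) => p; rewrite mem_primes => /and3P[pp _ pk].
rewrite p_part; set e := logn p k.
have e0 : (0 < e)%N by rewrite logn_gt0 mem_primes pp k0.
have pek : (p ^ e <= n.*2)%N by rewrite (leq_trans (dvdn_leq k0 (pfactor_dvdnn p k))).
have [pen|npe] := leqP (p ^ e) n.
  by rewrite dvdn_mulr// dvdn_lcm_upto// expn_gt0 prime_gt0.
rewrite -(prednK e0) expnSr dvdn_mul//; last first.
  by apply: (@prime_dvd_central_bin _ _ e) => //; rewrite npe.
apply: dvdn_lcm_upto; rewrite expn_gt0 prime_gt0//=.
rewrite -leq_double -muln2 (leq_trans _ pek)// -{2}(prednK e0) expnSr.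
by rewrite leq_mul2l prime_gt1// orbT.
Qed.

(** From [n] to [n + 1] the coefficient is multiplied by [2 (2n + 1) / (n + 1) < 4], and [n = 1]
    gives equality. The factor 2 is what later yields a halving. *)
Lemma central_bin_le n : (0 < n)%N -> ('C(n.*2, n) * 2 <= 4 ^ n)%N.
Proof.
case: n => // n _; elim: n => // n IH.
have E k : (k.+1 * 'C(k.+1.*2, k.+1) = 2 * (k.*2.+1 * 'C(k.*2, k)))%N.
  rewrite doubleS; have /= <- := mul_bin_diag k.*2.+2 k.
  have /= := mul_bin_down k.*2.+1 k; rewrite (_ : (k.*2.+1 - k = k.+1)%N); last lia.
  by nia.
rewrite -(leq_pmul2l (ltn0Sn n.+1)) mulnA E expnS.
set c := 'C(_, _) in IH *; set q := (4 ^ n.+1)%N in IH *.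
nia.
Qed.

(** * Integrality and fractional parts *)

Lemma natr_div_int (R : archiRealFieldType) (d k : nat) :
  (k %| d)%N -> (d%:R / k%:R : R) \is a Num.int.
Proof.
case/dvdnP => a ->; have [->|k0] := eqVneq k 0%N; first by rewrite muln0 mul0r.
by rewrite natrM mulfK ?pnatr_eq0// intr_nat.
Qed.

Lemma lcm_upto_harm_int (R : realType) n k : (k <= n)%N ->
  (lcm_upto n)%:R * harm R k.+1 \is a Num.int.
Proof.
move=> kn; rewrite /harm mulr_sumr big_nat rpred_sum// => i /andP[i0 ik].
by rewrite natr_div_int// dvdn_lcm_upto// i0 (leq_trans _ kn).
Qed.

Lemma lcm_upto_ratr_int (R : realType) n q : (`|denq q| <= n)%N ->
  (lcm_upto n)%:R * (ratr q : R) \is a Num.int.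
Proof.
move=> qn; rewrite /ratr mulrCA rpredM ?intr_int//.
rewrite -[X in X%:~R^-1]absz_denq -pmulrn natr_div_int// dvdn_lcm_upto//.
by rewrite absz_gt0 denq_neq0.
Qed.

Lemma frac_part_addz (R : realType) (x y : R) : y \is a Num.int ->
  frac_part (x + y) = frac_part x.
Proof.
by move=> yi; rewrite /frac_part (floorDrz x yi) intrD (floorK yi); ring.
Qed.

Lemma frac_part_id (R : realType) (x : R) : 0 <= x < 1 -> frac_part x = x.
Proof.
move=> x01; rewrite /frac_part (_ : Num.floor x = 0) ?subr0//.
by apply/eqP; rewrite floor_eq add0r.
Qed.

(** * The scaled forms and the irrationality of gamma *)

Definition scaled_form (R : realType) (m p : nat) : R :=
  (lcm_upto (2 ^ p))%:R * gamma_form R m (2 ^ p - m).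

Lemma scaled_form_gt0 (R : realType) m p : 0 < scaled_form R m p.
Proof. by rewrite mulr_gt0 ?gamma_form_gt0// ltr0n lcm_upto_gt0. Qed.

Lemma scaled_form_halve (R : realType) m p : (m <= 2 ^ p)%N ->
  scaled_form R m p.+1 <= 2^-1 * scaled_form R m p.
Proof.
move=> mp; rewrite /scaled_form expnS mul2n; set n := (2 ^ p)%N in mp *.
(* Doubling [n] with [m] fixed advances [w = n - m] by [n], which gives [n] divisions by 4. *)
have -> : (n.*2 - m = n - m + n)%N by lia.
have n0 : (0 < n)%N by rewrite expn_gt0.
set g := gamma_form R m (n - m); have g0 : 0 < g := gamma_form_gt0 R m _.
apply: (@le_trans _ _ ((lcm_upto n * 'C(n.*2, n))%:R * (4^-1 ^+ n * g))).
  apply: ler_pM => //; first exact/ltW/gamma_form_gt0.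
    rewrite ler_nat dvdn_leq ?lcm_upto_double// muln_gt0 lcm_upto_gt0 bin_gt0.
    by rewrite -addnn leq_addl.
  exact: gamma_form_decay.
rewrite natrM -!mulrA [leRHS]mulrCA ler_pM2l ?ltr0n ?lcm_upto_gt0//.
rewrite mulrA ler_pM2r// exprVn ler_pdivrMr ?exprn_gt0//.
rewrite -(ler_pM2r (ltr0n R 2)) mulrAC mulVf// mul1r -natrX -natrM ler_nat.
exact: central_bin_le.
Qed.

Lemma scaled_form_le (R : realType) m p j : (m <= 2 ^ p)%N ->
  scaled_form R m (p + j) <= scaled_form R m p / (2 ^ j)%:R.
Proof.
move=> mp; elim: j => [|j IH]; first by rewrite addn0 divr1.
rewrite addnS (le_trans (scaled_form_halve _ _))//.
  by rewrite (leq_trans mp)// leq_exp2l// leq_addr.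
by rewrite expnS natrM invfM [leRHS]mulrCA ler_pM2l ?invr_gt0.
Qed.

(** The least common multiple clears the denominators of [q] and of every harmonic number involved,
    so the two numbers differ by an integer before fractional parts are taken. *)
Lemma frac_seq_scaled_form (R : realType) m p q :
  (m <= 2 ^ p)%N -> (`|denq q| <= 2 ^ p)%N -> euler_gamma R = ratr q ->
  scaled_form R m p < 1 -> frac_seq R m p = scaled_form R m p.
Proof.
move=> mp qp gq x1; rewrite -[RHS]frac_part_id ?x1 ?(ltW (scaled_form_gt0 _ _ _))//.
rewrite /frac_seq /scaled_form /gamma_form subnK//.
set n := (2 ^ p)%N in qp *; set d : R := (lcm_upto n)%:R.
set S := \sum_(k < _) _.
rewrite -[RHS](@frac_part_addz _ _ ((-1) ^+ m * (d * S - d * euler_gamma R))).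
  by congr frac_part; ring.
rewrite rpredM ?rpredX ?rpredN1// rpredB//; last by rewrite gq lcm_upto_ratr_int.
rewrite mulr_sumr rpred_sum// => k _; rewrite mulrCA rpredM//.
  by rewrite !rpredM ?rpredX ?rpredN1 ?intr_nat.
by rewrite lcm_upto_harm_int// -ltnS.
Qed.

Theorem corollary2 (R : realType) :
  (exists m p0 : nat,
      (m <= 2 ^ p0)%N /\
      forall p : nat, (p0 <= p)%N -> frac_seq R m p <= frac_seq R m p.+1) ->
  @irrational R (euler_gamma R).
Proof.
move=> [m [p0 [mp0 frac_le]]] [q _ /esym gq].
(* The first summand of [j] makes [2 ^ j] exceed [x p0], so that [x p < 1]; the second makes [2 ^ p]
   at least the denominator of [q]. *)
pose x := scaled_form R m; pose j := (Num.bound (x p0) + `|denq q|)%N.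
pose p := (p0 + j)%N.
have jp : (j <= 2 ^ p)%N.
  by rewrite (leq_trans (ltnW (ltn_expl j (ltnSn 1))))// leq_exp2l// leq_addl.
have mp : (m <= 2 ^ p)%N by rewrite (leq_trans mp0)// leq_exp2l// leq_addr.
have qp : (`|denq q| <= 2 ^ p)%N by rewrite (leq_trans _ jp)// leq_addl.
have le2S : (2 ^ p <= 2 ^ p.+1)%N by rewrite leq_exp2l.
have xp0 : 0 < x p := scaled_form_gt0 R m p.
have x1 : x p < 1.
  apply: le_lt_trans (scaled_form_le R j mp0) _.
  rewrite ltr_pdivrMr ?ltr0n ?expn_gt0// mul1r.
  apply: lt_le_trans (archi_boundP (ltW (scaled_form_gt0 R m p0))) _.
  by rewrite ler_nat (leq_trans (leq_addr `|denq q| _))// ltnW// ltn_expl.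
have xS : x p.+1 <= 2^-1 * x p := scaled_form_halve R mp.
have xS1 : x p.+1 < 1 by lra.
(* Both fractional parts become scaled forms, and [x p <= x p.+1] contradicts the halving of the
   positive [x p]. *)
have := frac_le p (leq_addr _ _).
rewrite (frac_seq_scaled_form mp qp gq x1).
rewrite (frac_seq_scaled_form (leq_trans mp le2S) (leq_trans qp le2S) gq xS1).
by rewrite -/(x p) -/(x p.+1); lra.
Qed.
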